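(* Consider the problem $\min_{x\in\mathcal H}F(x)=f(x)+\psi(x)$ described in the context. Suppose there is $L\ge0$ with $$\|f'(y)-f'(x)-H(x)(y-x)\|_*\le L\|x-y\|\qquad\text{for all }x,y\in\mathcal H,$$ that the subproblem assumption (see context) holds with this $L$, and that $F$ satisfies the Polyak–Łojasiewicz condition: for some $\mu>0$, $$\frac1{2\mu}\operatorname{dist}(0,\partial F(x))^2\ge F(x)-F^*\qquad\text{for all }x\in\operatorname{dom}F.$$ Let $(x_k)_{k\in\mathbb N}$ be the iterates of the LeAP-SSN algorithm (see context) with arbitrary $x_0\in\operatorname{dom}F$. Then: (i) For all $k\ge0$, $$F(x_k)-F^*\le\exp\Big(-\frac{2\beta\alpha^2\mu}{2\beta\alpha^2\mu+\max\{2mL,\Lambda_0\}}\,k\Big)(F(x_0)-F^* ).$$ If in addition $\lambda_k\to0$ as $k\to\infty$, then $F(x_k)-F^*$ converges to $0$ superlinearly. (ii) $x_k$ converges strongly to a global minimiser $x^*$ of $F$, and for all $k\ge2$, $$\|x_k-x^*\|\le\exp\Big(-\frac{2\beta\alpha^2\mu}{4\beta\alpha^2\mu+2\max\{2mL,\Lambda_0\}}\,(k-2)\Big)\frac{5\sqrt{F(x_0)-F^*}}{\alpha\beta\mu^{1/2}}.$$ If in addition $\lambda_k\to0$ as $k\to\infty$, then $x_k$ converges to $x^*$ superlinearly. (iii) The number of Newton steps up to the end of iteration $k$, counted as $\sum_{i=0}^kj_i$, does not exceed $k+1+\log_2\max\{1/2,\,mL/\Lambda_0\}$.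
   Context: Setting. $\mathcal H$ is a real Hilbert space with norm $\|\cdot\|$, dual $\mathcal H^*$ with norm $\|\cdot\|_*$, duality pairing $\langle\cdot,\cdot\rangle$, and Riesz map $\mathcal R:\mathcal H\to\mathcal H^*$. $f\in C^{1,1}(\mathcal H;\mathbb R)$ (Fréchet differentiable with Lipschitz derivative $f'$, possibly nonconvex); $\psi:\mathcal H\to\mathbb R\cup\{+\infty\}$ is proper, convex, lower semicontinuous; $F=f+\psi$ is bounded below with minimal value $F^*$ and the solution set $S=\{x:F(x)=F^*\}$ is nonempty. $\operatorname{dom}F=\{F<+\infty\}$; $\partial\psi$ is the convex subdifferential and $\partial F(x)=f'(x)+\partial\psi(x)$; $\operatorname{dist}(0,\partial F(x))=\inf\{\|g\|_*:g\in\partial F(x)\}$ ($+\infty$ if $\partial F(x)=\emptyset$). To every $x\in\mathcal H$ is associated a symmetric bounded linear operator $H(x):\mathcal H\to\mathcal H^*$. Subproblem. For $x\in\operatorname{dom}F$ and $\lambda\ge0$ let $\widetilde F(y;x,\lambda)=f(x)+\langle f'(x),y-x\rangle+\frac12\langle H(x)(y-x),y-x\rangle+\frac\lambda2\|y-x\|^2+\psi(y)$. A point $x_+=x_+(\lambda,x)$ is an admissible solution if (FO) $-f'(x)-H(x)(x_+-x)-\lambda\mathcal R(x_+-x)\in\partial\psi(x_+)$ and (D) $\widetilde F(x_+;x,\lambda)\le\widetilde F(x;x,\lambda)=F(x)$. For such a point set $\psi'(x_+)=-f'(x)-H(x)(x_+-x)-\lambda\mathcal R(x_+-x)$ and $F'(x_+)=f'(x_+)+\psi'(x_+)\in\partial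 F(x_+)$. Subproblem assumption (with constant $L$): for all $\lambda\ge L$ and all $x\in\operatorname{dom}F$ an admissible solution exists (and can be computed). LeAP-SSN algorithm. Input: $m\ge1$, $\alpha\in(0,1/2]$, $\beta\in(0,(m-1)/(2m)]$, $x_0\in\operatorname{dom}F$, $\psi'(x_0)\in\partial\psi(x_0)$, $\Lambda_0>0$; $F'(x_0)=f'(x_0)+\psi'(x_0)$. At iteration $k=0,1,\dots$: for $j=0,1,\dots$, set $\lambda=2^j\Lambda_k$; take an admissible solution $x_+=x_+(\lambda,x_k)$ (if none exists, go to the next $j$); if $$\langle F'(x_+),x_k-x_+\rangle\ge\tfrac\alpha\lambda\|F'(x_+)\|_*^2\quad\text{and}\quad F(x_k)-F(x_+)\ge\beta\lambda\|x_+-x_k\|^2,$$ accept: set $j_k=j$, $x_{k+1}=x_+$, $\lambda_k=\lambda=2^{j_k}\Lambda_k$, $\Lambda_{k+1}=\lambda_k/2$, $F'(x_{k+1})=F'(x_+)$ and go to iteration $k+1$; otherwise go to the next $j$. Superlinear convergence of a nonnegative sequence $(a_k)$ to $0$ means $a_{k+1}\le\varepsilon_ka_k$ for all large $k$ with some $\varepsilon_k\to0$; $x_k\to x^*$ superlinearly means this for $a_k=\|x_k-x^*\|$. *)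

(* Defs.v *)
From HB Require Import structures.
From mathcomp Require Import all_boot all_order all_algebra sesquilinear.
From mathcomp Require Import all_classical all_reals all_analysis.
Set Implicit Arguments.
Unset Strict Implicit.
Unset Printing Implicit Defensive.
Import Order.TTheory GRing.Theory Num.Theory.
Import numFieldNormedType.Exports.
Local Open Scope classical_set_scope.
Local Open Scope ring_scope.

Section Hilbert.
Context {R : realType} {E : completeNormedModType R}.

(* With [hilbert_norm dot], the complete normed space [E] is a real Hilbert
   space whose inner product is [dot]; the Riesz map is then [x |-> dot x]. *)
Definition hilbert_norm (dot : {dot E for idfun}) : Prop :=
  forall x : E, `|x| ^+ 2 = dot x x.

(* Elements of the dual space are represented by functions [g : E -> R] that
   satisfy [in_dual], and the duality pairing <g, v> is the application [g v]. *)
Definition in_dual (g : E -> R) : Prop := scalar g /\ continuous g.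

(* A [sup] of reals is 0 on an unbounded set, so this is the dual norm only for
   [g] satisfying [in_dual]. *)
Definition dual_norm (g : E -> R) : R :=
  sup [set `|g v| | v in [set v : E | `|v| <= 1]].

(* The form [(u, v) |-> B u v] stands for the operator [u |-> B u] from [E] to
   its dual. *)
Definition bounded_operator (B : E -> E -> R) : Prop :=
  (forall u, in_dual (B u)) /\
  (exists C : R, forall u, dual_norm (B u) <= C * `|u|).

Definition C11 (f : E -> R) : Prop :=
  (forall x, differentiable f x) /\
  (exists K : R, forall x y,
    dual_norm (fun v => 'd f x v - 'd f y v) <= K * `|x - y|).

End Hilbert.

Section ExtendedValued.
Context {R : realType} {E : completeNormedModType R}.
Local Open Scope ereal_scope.
Implicit Type psi : E -> \bar R.

Definition effective_domain psi : set E := [set x | psi x < +oo].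

Definition proper_efun psi : Prop :=
  (forall x, psi x != -oo) /\ effective_domain psi !=set0.

Definition convex_efun psi : Prop :=
  forall (x y : E) (t : R), (0 <= t <= 1)%R ->
    psi (t *: x + (1 - t) *: y)%R <= t%:E * psi x + (1 - t)%:E * psi y.

Definition subdifferential psi (x : E) : set (E -> R) :=
  [set g | in_dual g /\ forall y, psi x + (g (y - x)%R)%:E <= psi y].

End ExtendedValued.

Section CompositeProblem.
Context {R : realType} {E : completeNormedModType R}.
Variables (f : E -> R) (psi : E -> \bar R).
Local Open Scope ereal_scope.

Definition objective (x : E) : \bar R := (f x)%:E + psi x.

Definition objective_subdifferential (x : E) : set (E -> R) :=
  [set (fun v => 'd f x v + g v)%R | g in subdifferential psi x].

Definition dist0_subdifferential (x : E) : \bar R :=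
  ereal_inf [set (dual_norm g)%:E | g in objective_subdifferential x].

Definition solution_set (Fstar : R) : set E :=
  [set x | objective x = Fstar%:E].

Definition PL_condition (Fstar mu : R) : Prop :=
  forall x, effective_domain objective x ->
    (2 * mu)^-1%:E * dist0_subdifferential x ^+ 2 >= objective x - Fstar%:E.

End CompositeProblem.

Section Subproblem.
Context {R : realType} {E : completeNormedModType R}.
Variables (dot : {dot E for idfun}) (f : E -> R) (psi : E -> \bar R).
Variable H : E -> {symmetric E}.

Definition newton_model (x : E) (lambda : R) (y : E) : \bar R :=
  ((f x + 'd f x (y - x) + H x (y - x) (y - x) / 2
     + lambda / 2 * `|y - x| ^+ 2)%:E + psi y)%E.

(* The subgradient psi'(x_+) of psi given by the optimality condition. *)
Definition step_psi' (x : E) (lambda : R) (xp : E) : E -> R :=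
  fun v => - 'd f x v - H x (xp - x) v - lambda * dot (xp - x) v.

(* F'(x_+) = f'(x_+) + psi'(x_+). *)
Definition step_F' (x : E) (lambda : R) (xp : E) : E -> R :=
  fun v => 'd f xp v + step_psi' x lambda xp v.

Definition admissible (x : E) (lambda : R) (xp : E) : Prop :=
  subdifferential psi xp (step_psi' x lambda xp) /\
  (newton_model x lambda xp <= newton_model x lambda x)%E.

Definition subproblem_assumption (L : R) : Prop :=
  forall (lambda : R) (x : E), L <= lambda ->
    effective_domain (objective f psi) x ->
    exists xp, admissible x lambda xp.

Variables (alpha beta : R).

Definition accepted (x : E) (lambda : R) (xp : E) : Prop :=
  alpha / lambda * dual_norm (step_F' x lambda xp) ^+ 2
    <= step_F' x lambda xp (x - xp) /\
  ((beta * lambda * `|xp - x| ^+ 2)%:E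
    <= objective f psi x - objective f psi xp)%E.

(* The trial with parameter [lambda] leads to the next [j]: there is no
   admissible solution, or the one that was taken fails the acceptance test. *)
Definition trial_rejected (x : E) (lambda : R) : Prop :=
  (~ exists xp, admissible x lambda xp) \/
  (exists xp, admissible x lambda xp /\ ~ accepted x lambda xp).

(* [LeAP_SSN x0 psi'0 Lambda0 x F' lambda Lambda j] : the sequences are
   generated by a run of the algorithm. The admissible solution taken in each
   trial is not determined by the algorithm, so this is a relation. *)
Record LeAP_SSN (x0 : E) (psi'0 : E -> R) (Lambda0 : R)
    (x : nat -> E) (F' : nat -> E -> R) (lambda Lambda : nat -> R)
    (j : nat -> nat) : Prop := {
  leap_x0 : x 0%N = x0 ;
  leap_F'0 : F' 0%N = (fun v => 'd f x0 v + psi'0 v) ;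
  leap_Lambda0 : Lambda 0%N = Lambda0 ;
  leap_rejected : forall k i : nat, (i < j k)%N ->
    trial_rejected (x k) (2 ^+ i * Lambda k) ;
  leap_lambda : forall k, lambda k = 2 ^+ j k * Lambda k ;
  leap_admissible : forall k, admissible (x k) (lambda k) (x k.+1) ;
  leap_accepted : forall k, accepted (x k) (lambda k) (x k.+1) ;
  leap_Lambda : forall k, Lambda k.+1 = lambda k / 2 ;
  leap_F' : forall k, F' k.+1 = step_F' (x k) (lambda k) (x k.+1)
}.

End Subproblem.

Section Rates.
Context {R : realType}.

Definition superlinear (a : nat -> R) : Prop :=
  exists eps : nat -> R, eps @ \oo --> (0 : R) /\
    \forall k \near \oo, a k.+1 <= eps k * a k.

Definition log2 (z : R) : R := ln z / ln 2.

End Rates.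

(* Main.v *)
From HB Require Import structures.
Require Import Defs.
From mathcomp Require Import all_boot all_order all_algebra sesquilinear.
From mathcomp Require Import all_classical all_reals all_analysis.
From mathcomp Require Import ring lra.
Import Order.TTheory GRing.Theory Num.Theory.
Import numFieldNormedType.Exports.
Local Open Scope classical_set_scope.
Local Open Scope ring_scope.

(** Write [F = f + psi], [a k = F (x k) - Fstar], [r k = |x k.+1 - x k|],
    [s k = sqrt (a k)] and [c = 2 beta alpha^2 mu].

    The derivative error [e = f'(x+) - f'(x) - H(x)(x+ - x)] has dual norm at
    most [L |x+ - x|], and [F'(x+) = e - lambda R (x+ - x)] where [R] is the
    Riesz map. Expanding the square of the dual norm of [F'(x+)]
    ([dual_norm_sub_riesz]) gives the first acceptance test as soon as
    [lambda >= L]; the decrease of the model, with a Taylor bound for [f]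
    ([newton_taylor_upper]), gives the second one as soon as [lambda >= m L]
    ([accepted_large]). A rejected parameter is therefore smaller than [m L],
    so doubling stops below [2 m L] and every [lambda k] is at most
    [max (2 m L) Lambda0] ([run_lambda_le]). Since the product of the factors
    [2 ^ (j i) / 2] is [Lambda k / Lambda0], the same bound counts the trials
    ([run_trial_count_log2]).

    The convergence statements use only two scalar consequences of acceptance,
    the descent [beta lambda_k r_k^2 <= a_k - a_(k+1)] and, by the
    Polyak-Lojasiewicz inequality and the first test ([accepted_value_le]),
    [2 mu alpha^2 a_(k+1) <= (lambda_k r_k)^2]. Eliminating [r_k]
    gives [a_(k+1) <= lambda_k / (lambda_k + c) a_k] ([value_contraction]),
    hence the linear rate, and the superlinear one when [lambda_k] tends to
    0.

    For the iterates, small [lambda_k] make the descent inequality useless as a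
    bound on [r_k] by itself. As [lambda_k >= lambda_(k-1) / 2], however, a
    small [lambda_k] forces [a_k] to be small compared with [a_(k-1)]. Both
    regimes are covered by one telescoping estimate ([step_le_telescoping]),
    [alpha beta sqrt(mu) r_(k+1) <= (s_k - s_(k+1)) + 3 (s_(k+1) - s_(k+2))],
    so the path has finite length and its tail after [x_(k+1)] is at most
    [4 s_k / (alpha beta sqrt mu)]. If moreover [lambda_k] tends to 0,
    the distance from [x_(k+1)] to the limit, at most [r_(k+1)] plus a multiple
    of [s_(k+1)], is negligible with respect to [r_k], because [s_(k+1)] is at
    most a multiple of [lambda_k r_k] ([trajectory_superlinear]). The limit is a
    minimiser by lower semicontinuity ([objective_limit_le]). *)

Set Implicit Arguments.
Unset Strict Implicit.
Unset Printing Implicit Defensive.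

(** * Continuous linear forms and their dual norm *)

Section DualNorm.
Context {R : realType} {E : completeNormedModType R}.
Implicit Types g h : E -> R.

Lemma in_dualD g h : in_dual g -> in_dual h -> in_dual (fun v => g v + h v).
Proof.
move=> [gl gc] [hl hc]; split; first by move=> a u v; rewrite gl hl; ring.
by move=> v; exact: continuousD (gc v) (hc v).
Qed.

Lemma in_dualN g : in_dual g -> in_dual (fun v => - g v).
Proof.
move=> [gl gc]; split; first by move=> a u v; rewrite gl; ring.
by move=> v; exact: continuousN (gc v).
Qed.

Lemma in_dual_diff (f : E -> R) (x : E) :
  differentiable f x -> in_dual ('d f x : E -> R).
Proof. by move=> fx; split; [exact: linearP|exact: diff_continuous]. Qed.

Lemma in_dual0 g : in_dual g -> g 0 = 0.
Proof. by case=> gl _; have := gl 1 0 0; rewrite scale1r addr0; lra. Qed.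

Lemma in_dualZ g a v : in_dual g -> g (a *: v) = a * g v.
Proof.
by move=> gd; have := gd.1 a v 0; rewrite !addr0 (in_dual0 gd) addr0.
Qed.

Lemma dual_norm_has_ubound g : in_dual g ->
  has_ubound [set `|g v| | v in [set v : E | `|v| <= 1]].
Proof.
move=> [gl gc].
pose glin := GRing.isLinear.Build R E R^o *:%R g gl.
pose G : {linear E -> R^o} := HB.pack g glin.
have /linear_boundedP [C [_ hC]] : bounded_near G (nbhs 0).
  by apply/linear_bounded_continuous.
have C1 : C < Num.max C 0 + 1 by rewrite ltr_pwDr// le_max lexx.
exists (Num.max C 0 + 1) => _ [v /= v1 <-].
apply: (le_trans (hC _ C1 v)).
by rewrite ler_piMr// addr_ge0// le_max lexx orbT.
Qed.

Lemma dual_norm_ge0 g : in_dual g -> 0 <= dual_norm g.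
Proof.
move=> gd; apply: (ub_le_sup (dual_norm_has_ubound gd)).
by exists 0; rewrite /= ?normr0 ?ler01// (in_dual0 gd) normr0.
Qed.

Lemma dual_norm_pairing g v : in_dual g -> `|g v| <= dual_norm g * `|v|.
Proof.
move=> gd; have [->|v0] := eqVneq v 0.
  by rewrite (in_dual0 gd) !normr0 mulr0.
rewrite -ler_pdivrMr ?normr_gt0//.
apply: (ub_le_sup (dual_norm_has_ubound gd)).
exists (`|v|^-1 *: v) => /=.
  by rewrite normrZ ger0_norm ?invr_ge0// mulVf// normr_eq0.
by rewrite (in_dualZ _ _ gd) normrM ger0_norm ?invr_ge0// mulrC.
Qed.

Lemma dual_norm_le g C :
  (forall v, `|v| <= 1 -> `|g v| <= C) -> dual_norm g <= C.
Proof.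
move=> gC; apply: ge_sup; first by exists `|g 0|, 0 => //=; rewrite normr0.
by move=> _ [v v1 <-]; exact: gC.
Qed.

Lemma hilbert_normD (dot : {dot E for idfun}) (a b : R) (u w : E) :
  hilbert_norm dot -> `|a *: u + b *: w| ^+ 2
    = a ^+ 2 * `|u| ^+ 2 + 2 * a * b * dot w u + b ^+ 2 * `|w| ^+ 2.
Proof.
move=> hdot; rewrite !hdot.
have sym : dot u w = dot w u by rewrite hermitian_subproof expr0 mul1r.
rewrite linearDl !linearDr !linearZl_LR !linearZr_LR /= sym.
set X : R := dot u u; set Y : R := dot w w; set Z : R := dot w u.
rewrite /GRing.scale /=; ring.
Qed.

(** With [g = e - lam R d], testing the bound on [e] at [w = g(v) v + lam d],
    the direction that represents [g] on the span of [v] and [d], yields the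
    expansion of the squared norm without representing [e] itself by a
    vector. *)
Lemma dual_norm_sub_riesz (dot : {dot E for idfun}) (e : E -> R) (N lam : R)
    (d : E) : hilbert_norm dot -> scalar e -> (forall w, `|e w| <= N * `|w|) ->
    in_dual (fun v => e v - lam * dot d v) ->
  dual_norm (fun v => e v - lam * dot d v) ^+ 2
    <= N ^+ 2 - 2 * lam * e d + lam ^+ 2 * `|d| ^+ 2.
Proof.
move=> hdot el eN gd.
have key v : `|v| <= 1 -> (e v - lam * dot d v) ^+ 2
    <= N ^+ 2 - 2 * lam * e d + lam ^+ 2 * `|d| ^+ 2.
  move=> v1; set q := e v - lam * dot d v; set p := dot d v.
  have eZ a u : e (a *: u) = a * e u.
    have e0 : e 0 = 0 by have := el 1 0 0; rewrite scale1r addr0; lra.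
    by have := el a u 0; rewrite !addr0 e0 addr0.
  have ew : e (q *: v + lam *: d) = q * e v + lam * e d by rewrite el eZ.
  have nw : `|q *: v + lam *: d| ^+ 2
      = q ^+ 2 * `|v| ^+ 2 + 2 * q * lam * p + lam ^+ 2 * `|d| ^+ 2.
    exact: hilbert_normD.
  have v2 : `|v| ^+ 2 <= 1 by rewrite expr_le1.
  have := le_trans (ler_norm _) (eN (q *: v + lam *: d)).
  rewrite ew; set W := `|q *: v + lam *: d| in nw *.
  have evE : e v = q + lam * p by rewrite /q /p; ring.
  rewrite evE => h; have NW : 0 <= (N - W) ^+ 2 by exact: sqr_ge0.
  (* [e w <= N W <= (N^2 + W^2) / 2] is the claim once [W^2] is expanded. *)
  have q2 : q ^+ 2 * `|v| ^+ 2 <= q ^+ 2 by rewrite ler_piMr ?sqr_ge0.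
  nra.
rewrite -(@ler_sqrt _ (dual_norm _ ^+ 2)); last first.
  by apply: le_trans (key 0 _); rewrite ?sqr_ge0 ?normr0.
rewrite sqrtr_sqr ger0_norm ?dual_norm_ge0//.
apply: dual_norm_le => v v1; rewrite -sqrtr_sqr ler_sqrt ?key//.
exact: le_trans (sqr_ge0 _) (key v v1).
Qed.

(** The mean value theorem applied to
    [t |-> f (x + t d) - t f'(x) d - t^2 b / 2], whose derivative is nonpositive
    on the open unit interval. *)
Lemma taylor_upper (f : E -> R) (x d : E) (b : R) :
  (forall y, differentiable f y) ->
  (forall t : R, 0 < t < 1 -> 'd f (x + t *: d) d <= 'd f x d + b * t) ->
  f (x + d) <= f x + 'd f x d + b / 2.
Proof.
move=> fd hb; set p := 'd f x d.
pose phi (t : R) : R := f (x + t *: d) - p * t - b / 2 * t ^+ 2.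
have der (t : R) :
    is_derive t 1 (fun t : R => f (x + t *: d)) ('d f (x + t *: d) d).
  rewrite -(deriveE d (fd _)).
  have E1 : (fun h : R => h^-1 *: (f (x + (h *: 1 + t) *: d) - f (x + t *: d)))
     = (fun h : R => h^-1 *: (f (h *: d + (x + t *: d)) - f (x + t *: d))).
    apply/funext => h; congr (_ *: (f _ - _)).
    by rewrite [h *: 1](mulr1 h) scalerDl addrCA.
  have dd := diff_derivable (fd (x + t *: d)) (v := d).
  split; first by rewrite /derivable /= E1.
  by rewrite /derive /= E1.
have dphi (t : R) : is_derive t 1 phi ('d f (x + t *: d) d - p - b * t).
  have -> : 'd f (x + t *: d) d - p - b * t
     = 'd f (x + t *: d) d - p *: 1 - (b / 2) *: (t *: 1 + t *: 1).
    by rewrite /GRing.scale /=; field.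
  rewrite /phi; under eq_fun do rewrite expr2.
  exact: is_deriveB.
have [c c01] : exists2 c, c \in `]0, 1[ & phi 1 - phi 0
    = ('d f (x + c *: d) d - p - b * c) * (1 - 0).
  apply: MVT => //; apply: continuous_subspaceT => t.
  by apply: differentiable_continuous; apply/derivable1_diffP; case: (dphi t).
rewrite in_itv /= in c01; have := hb c c01.
rewrite /phi scale1r scale0r addr0 -/p; lra.
Qed.

End DualNorm.

(** * Two convergence criteria *)

Section AbstractConvergence.
Context {R : realType}.

(** Summing the steps bounds [|y k - y n|] by [V k - V n <= V k] for
    [k <= n]; this gives the Cauchy property and, in the limit, the error
    bound. *)
Lemma cvg_of_telescoping_steps {E : completeNormedModType R}
    (y : nat -> E) (V : nat -> R) :
  (forall k, 0 <= V k) -> V @ \oo --> (0 : R) ->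
  (forall k, `|y k.+1 - y k| <= V k - V k.+1) ->
  exists2 l : E, y @ \oo --> l & forall k, `|y k - l| <= V k.
Proof.
move=> V0 Vcvg hy.
have dist k n : `|y k - y (k + n)%N| <= V k - V (k + n)%N.
  elim: n => [|n IH]; first by rewrite addn0 !subrr normr0.
  rewrite addnS; have := ler_distD (y (k + n)%N) (y k) (y (k + n).+1).
  have := hy (k + n)%N; rewrite (distrC (y (k + n).+1)); lra.
have distV k n : (k <= n)%N -> `|y k - y n| <= V k.
  move=> kn; rewrite -(subnKC kn); apply: (le_trans (dist _ _)).
  by rewrite lerBlDr lerDl.
have : cvg (y @ \oo).
  apply/cauchy_cvgP/cauchy_exP => e e0.
  have [N _ hN] := cvgr_lt _ Vcvg _ e0.
  exists (y N); exists N => // n /= Nn.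
  rewrite -ball_normE /=; apply: (le_lt_trans (distV _ _ Nn)).
  exact: hN N (leqnn N).
move=> /cvg_ex[l yl]; exists l => // k.
have h : (fun n => `|y k - y n|) @ \oo --> `|y k - l|.
  by apply: cvg_norm; apply: cvgB => //; exact: cvg_cst.
by apply: (cvgr_to_le h); exists k => // n /= kn; exact: distV.
Qed.

(** Here [t] is a distance to the limit and [r] a step length. Inserting
    [r k <= t k + t k.+1] and absorbing [eta k * t k.+1] once [eta k] is below
    one half doubles the rate [eta]. *)
Lemma superlinear_of_small_steps (t r eta : nat -> R) :
  (forall k, 0 <= t k) -> (forall k, 0 <= eta k) -> eta @ \oo --> (0 : R) ->
  (forall k, t k.+1 <= eta k * r k) -> (forall k, r k <= t k + t k.+1) ->
  superlinear t.
Proof.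
move=> t0 eta0 etacvg tr rt; exists (fun k => 2 * eta k); split.
  by rewrite -[X in _ --> X](mulr0 2); exact: cvgMr.
have half0 : 0 < 2^-1 :> R by rewrite invr_gt0.
have [N _ hN] := cvgr_lt _ etacvg _ half0.
exists N => // k /= Nk; have e2 := hN k Nk; rewrite /= in e2.
have h : t k.+1 <= eta k * (t k + t k.+1).
  by apply: (le_trans (tr k)); rewrite ler_wpM2l.
have h2 : eta k * t k.+1 <= 2^-1 * t k.+1 by rewrite ler_wpM2r// ltW.
by rewrite mulrDr in h; lra.
Qed.

End AbstractConvergence.

(** * Descent sequences under a gradient-domination inequality *)

Section DescentSequence.
Context {R : realType} (alpha beta mu : R) (a r lambda : nat -> R).
Hypotheses (alpha_gt0 : 0 < alpha) (beta_gt0 : 0 < beta) (mu_gt0 : 0 < mu).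
Hypothesis a_ge0 : forall k, 0 <= a k.
Hypothesis r_ge0 : forall k, 0 <= r k.
Hypothesis lambda_gt0 : forall k, 0 < lambda k.
Hypothesis lambda_half : forall k, lambda k / 2 <= lambda k.+1.
Hypothesis descent : forall k,
  beta * lambda k * r k ^+ 2 <= a k - a k.+1.
Hypothesis PL_step : forall k,
  2 * mu * alpha ^+ 2 * a k.+1 <= (lambda k * r k) ^+ 2.

Let c := 2 * beta * alpha ^+ 2 * mu.
Let s k : R := Num.sqrt (a k).

Let c_gt0 : 0 < c. Proof. by rewrite /c !mulr_gt0// exprn_gt0. Qed.

(** Both hypotheses bound [lambda k * r k ^+ 2], from above and from below;
    eliminating it leaves a contraction with factor
    [lambda k / (lambda k + c)]. *)
Lemma value_contraction k : c * a k.+1 <= lambda k * (a k - a k.+1).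
Proof.
have h1 : beta * (2 * mu * alpha ^+ 2 * a k.+1)
  <= beta * (lambda k * r k) ^+ 2 by rewrite ler_wpM2l// ltW.
have h2 : lambda k * (beta * lambda k * r k ^+ 2)
  <= lambda k * (a k - a k.+1) by rewrite ler_wpM2l// ltW.
rewrite /c; nra.
Qed.

Lemma value_nonincreasing k : a k.+1 <= a k.
Proof.
rewrite -subr_ge0; apply: le_trans (descent k).
by rewrite !mulr_ge0 ?sqr_ge0// ltW.
Qed.

Lemma value_linear_rate M k : (forall i, lambda i <= M) ->
  a k <= expR (- (c / (c + M) * k%:R)) * a 0%N.
Proof.
move=> lM; elim: k => [|k IH]; first by rewrite mulr0 oppr0 expR0 mul1r.
have cM0 : 0 < c + M by rewrite addr_gt0// (lt_le_trans (lambda_gt0 0%N)).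
have step : a k.+1 <= (1 - c / (c + M)) * a k.
  have -> : (1 - c / (c + M)) = M / (c + M) by field; rewrite gt_eqF.
  rewrite mulrAC ler_pdivlMr//.
  have h1 := value_contraction k.
  have h2 : lambda k * (a k - a k.+1) <= M * (a k - a k.+1).
    by rewrite ler_wpM2r// subr_ge0 value_nonincreasing.
  nra.
apply: (le_trans step).
have -> : - (c / (c + M) * k.+1%:R)
    = - (c / (c + M)) + - (c / (c + M) * k%:R).
  by rewrite -[k.+1]addn1 natrD; ring.
rewrite expRD -mulrA; apply: ler_pM => //.
  have -> : (1 - c / (c + M)) = M / (c + M) by field; rewrite gt_eqF.
  by rewrite divr_ge0 ?(ltW cM0)// (le_trans _ (lM 0%N))// ltW.
exact: expR_ge1Dx.
Qed.

Lemma value_cvg0 M : (forall i, lambda i <= M) -> a @ \oo --> (0 : R).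
Proof.
move=> lM.
have cM0 : 0 < c + M by rewrite addr_gt0// (lt_le_trans (lambda_gt0 0%N)).
apply: (@squeeze_cvgr _ _ _ _ (fun=> 0)
  (fun k => expR (- (c / (c + M))) ^+ k * a 0%N)).
- near=> k; rewrite a_ge0 /= (le_trans (value_linear_rate k lM))//.
  by rewrite -mulNr expRM_natr.
- exact: cvg_cst.
- rewrite -[X in _ --> X](mul0r (a 0%N)); apply: cvgMl; apply: cvg_expr.
  rewrite ger0_norm ?expR_ge0// -expR0 ltr_expR oppr_lt0 divr_gt0//.
Unshelve. all: by end_near. Qed.

Lemma value_superlinear : lambda @ \oo --> (0 : R) -> superlinear a.
Proof.
move=> l0; exists (fun k => lambda k / c); split.
  by rewrite -[X in _ --> X](mul0r c^-1); exact: cvgMl.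
near=> k; rewrite mulrAC ler_pdivlMr// mulrC.
apply: (le_trans (value_contraction k)).
by rewrite ler_wpM2l ?(ltW (lambda_gt0 _))// gerBl.
Unshelve. all: by end_near. Qed.

Let s_ge0 k : 0 <= s k. Proof. exact: sqrtr_ge0. Qed.
Let s2 k : s k ^+ 2 = a k. Proof. exact: sqr_sqrtr. Qed.

(** The square root of the gradient-domination hypothesis; bounding its factor
    2 below by 1 keeps [sqrt 2] out of the later constants. *)
Lemma sqrt_value_le_step k : alpha * Num.sqrt mu * s k.+1 <= lambda k * r k.
Proof.
have lr0 : 0 <= lambda k * r k by rewrite mulr_ge0// ltW.
rewrite -ler_sqr ?nnegrE ?lr0 ?mulr_ge0 ?(ltW alpha_gt0)//.
apply: le_trans (PL_step k).
rewrite !exprMn s2 sqr_sqrtr ?(ltW mu_gt0)//.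
have : 0 <= mu * alpha ^+ 2 * a k.+1 by rewrite !mulr_ge0 ?sqr_ge0// ltW.
by nra.
Qed.

(** If [s k.+2] is at least half of [s k.+1], descent divided by
    [s k.+2 <= lambda r / (alpha sqrt mu)] bounds the step by the last
    difference. Otherwise [s k.+1 - s k.+2] is comparable to [s k.+1], and the
    contraction of the previous iteration, through [lambda k <= 2 lambda k.+1],
    bounds the step by the square root of [s k ^+ 2 - s k.+1 ^+ 2]. *)
Lemma step_le_telescoping k : alpha * beta * Num.sqrt mu * r k.+1
  <= (s k - s k.+1) + 3 * (s k.+1 - s k.+2).
Proof.
set q := Num.sqrt mu.
have q0 : 0 < q by rewrite sqrtr_gt0.
have q2 : q ^+ 2 = mu by rewrite sqr_sqrtr ?ltW.
have s01 : s k.+1 <= s k by rewrite ler_wsqrtr// value_nonincreasing.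
have s12 : s k.+2 <= s k.+1 by rewrite ler_wsqrtr// value_nonincreasing.
have hl := lambda_gt0 k.+1; have hr := r_ge0 k.+1.
have hd := descent k.+1; rewrite -!s2 in hd.
have h0 := s_ge0 k; have h1 := s_ge0 k.+1; have h2 := s_ge0 k.+2.
have [half|half] := leP (s k.+1) (2 * s k.+2).
- have [s10|s10] := eqVneq (s k.+1) 0.
    have r2 : beta * lambda k.+1 * r k.+1 ^+ 2 <= 0 by nra.
    have r0 : r k.+1 = 0.
      apply/eqP; rewrite -sqrf_eq0 eq_le sqr_ge0 andbT.
      by rewrite -(pmulr_rle0 _ (mulr_gt0 beta_gt0 hl)).
    rewrite r0; nra.
  have s2gt0 : 0 < s k.+2.
    have : 0 < s k.+1 by rewrite lt_def s10.
    lra.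
  rewrite -(ler_pM2r s2gt0).
  have h3 : beta * r k.+1 * (alpha * q * s k.+2)
      <= beta * r k.+1 * (lambda k.+1 * r k.+1).
    by rewrite ler_wpM2l ?sqrt_value_le_step// mulr_ge0// ltW.
  nra.
- have hs1 : 0 < s k.+1 by lra.
  have hc := value_contraction k; rewrite -!s2 in hc.
  have hL := lambda_half k.
  have D : 0 <= s k ^+ 2 - s k.+1 ^+ 2 by nra.
  have hc2 : c * s k.+1 ^+ 2 <= 2 * lambda k.+1 * (s k ^+ 2 - s k.+1 ^+ 2).
    by apply: (le_trans hc); rewrite ler_wpM2r//; lra.
  have hd2 : beta * lambda k.+1 * r k.+1 ^+ 2 <= s k.+1 ^+ 2 by nra.
  (* The product of [hc2] and [hd2], in which the factor
     [lambda k.+1 * s k.+1 ^+ 2] cancels. *)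
  have key : (alpha * beta * q * r k.+1) ^+ 2 <= s k ^+ 2 - s k.+1 ^+ 2.
    have P0 : 0 < lambda k.+1 * s k.+1 ^+ 2 by rewrite mulr_gt0// exprn_gt0.
    rewrite -(ler_pM2r P0).
    have -> : (alpha * beta * q * r k.+1) ^+ 2 * (lambda k.+1 * s k.+1 ^+ 2)
       = beta * lambda k.+1 * r k.+1 ^+ 2 * (c * s k.+1 ^+ 2) / 2.
      by rewrite /c -q2; field.
    have -> : (s k ^+ 2 - s k.+1 ^+ 2) * (lambda k.+1 * s k.+1 ^+ 2)
       = s k.+1 ^+ 2 * (2 * lambda k.+1 * (s k ^+ 2 - s k.+1 ^+ 2)) / 2.
      by field.
    rewrite ler_pM2r ?invr_gt0//; apply: ler_pM => //.
      by rewrite !mulr_ge0 ?sqr_ge0// ltW.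
    by rewrite mulr_ge0 ?sqr_ge0// ltW.
  rewrite -ler_sqr ?nnegrE; last 2 first.
  + by rewrite !mulr_ge0// ltW.
  + by nra.
  (* With [u = s k - s k.+1] and [v = 3 (s k.+1 - s k.+2) >= 3/2 s k.+1],
     [(u + v)^2 >= u^2 + 2 u s k.+1]. *)
  by apply: (le_trans key); nra.
Qed.

Lemma sqrt_value_nonincreasing k : s k.+1 <= s k.
Proof. by rewrite ler_wsqrtr// value_nonincreasing. Qed.

Let K := alpha * beta * Num.sqrt mu.
Let K_gt0 : 0 < K. Proof. by rewrite !mulr_gt0// sqrtr_gt0. Qed.

Lemma trajectory_cvg {E : completeNormedModType R} (x : nat -> E) M :
  (forall k, r k = `|x k.+1 - x k|) -> (forall k, lambda k <= M) ->
  exists2 xs, x @ \oo --> xs & forall k, `|x k.+1 - xs| <= 4 * s k / K.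
Proof.
move=> hr lM; pose V k := (s k + 3 * s k.+1) / K.
have scvg : s @ \oo --> (0 : R).
  rewrite -[X in _ --> X](sqrtr0 R).
  exact: (continuous_cvg _ (@sqrt_continuous R 0) (value_cvg0 lM)).
have Vcvg : V @ \oo --> (0 : R).
  have -> : (0 : R) = (0 + 3 * 0) / K by rewrite mulr0 addr0 mul0r.
  apply: cvgMl; apply: cvgD => //; apply: cvgMr.
  by rewrite (cvg_shiftS s).
have V0 k : 0 <= V k.
  by rewrite divr_ge0 ?(ltW K_gt0)// addr_ge0// mulr_ge0.
have [k|l yl hl] := cvg_of_telescoping_steps (y := fun k => x k.+1) V0 Vcvg.
  rewrite -hr /V -mulrBl ler_pdivlMr// mulrC.
  by have := step_le_telescoping k; rewrite -/K; lra.
exists l; first by rewrite -(cvg_shiftS x).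
move=> k; apply: (le_trans (hl k)); rewrite /V ler_pM2r ?invr_gt0//.
by have := sqrt_value_nonincreasing k; lra.
Qed.

(** The square root halves the exponent of the value rate; one index is given
    up by bounding [s k.+1] by [s k]. *)
Lemma trajectory_linear_rate M k : (forall k, lambda k <= M) ->
  4 * s k.+1 / K <= expR (- (c / (2 * (c + M)) * k%:R)) * (5 * s 0%N / K).
Proof.
move=> lM; have -> : expR (- (c / (2 * (c + M)) * k%:R)) * (5 * s 0%N / K)
  = 5 * (expR (- (c / (2 * (c + M)) * k%:R)) * s 0%N) / K by ring.
rewrite ler_pM2r ?invr_gt0//; apply: ler_pM => //; first by rewrite ler_nat.
apply: (le_trans (sqrt_value_nonincreasing k)).
have cM0 : 0 < c + M by rewrite addr_gt0// (lt_le_trans (lambda_gt0 0%N)).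
rewrite -ler_sqr ?nnegrE ?mulr_ge0 ?expR_ge0// exprMn !s2 -expRM_natr.
have -> : - (c / (2 * (c + M)) * k%:R) * 2 = - (c / (c + M) * k%:R).
  by field; rewrite gt_eqF.
exact: value_linear_rate.
Qed.

(** Step [k.+1] and the tail after it are both small compared with step [k]:
    the former by descent and [lambda k <= 2 lambda k.+1], with factor of order
    [sqrt (lambda k)], the latter by [sqrt_value_le_step], with factor of order
    [lambda k]. *)
Lemma trajectory_superlinear {E : completeNormedModType R} (x : nat -> E)
    (xs : E) :
  (forall k, r k = `|x k.+1 - x k|) ->
  (forall k, `|x k.+1 - xs| <= 4 * s k / K) ->
  lambda @ \oo --> (0 : R) -> superlinear (fun k => `|x k - xs|).
Proof.
move=> hr hxs l0.
pose P := alpha * Num.sqrt mu.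
have P0 : 0 < P by rewrite mulr_gt0// sqrtr_gt0.
pose B := beta * P ^+ 2.
have B0 : 0 < B by rewrite mulr_gt0// exprn_gt0.
have lB k : 0 <= lambda k / B by rewrite divr_ge0// ltW.
have step k : r k.+1 <= Num.sqrt (lambda k / B) * r k.
  have hd := descent k.+1; have hs := sqrt_value_le_step k.
  have hL := lambda_half k; have hl := lambda_gt0 k.
  rewrite -ler_sqr ?nnegrE ?mulr_ge0 ?sqrtr_ge0// exprMn sqr_sqrtr//.
  rewrite mulrAC ler_pdivlMr//.
  have h1 : 2 * mu * alpha ^+ 2 * (beta * lambda k.+1 * r k.+1 ^+ 2)
      <= (lambda k * r k) ^+ 2.
    apply: le_trans (PL_step k); rewrite ler_wpM2l//.
      by rewrite !mulr_ge0 ?sqr_ge0// ltW.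
    by apply: (le_trans hd); rewrite gerBl.
  rewrite -(ler_pM2l hl).
  have -> : lambda k * (lambda k * r k ^+ 2) = (lambda k * r k) ^+ 2 by ring.
  apply: le_trans h1.
  have P2 : P ^+ 2 = alpha ^+ 2 * mu by rewrite exprMn sqr_sqrtr// ltW.
  rewrite /B P2.
  have W : 0 <= mu * alpha ^+ 2 * beta * r k.+1 ^+ 2.
    by rewrite !mulr_ge0 ?sqr_ge0// ltW.
  have := ler_wpM2r W hL; lra.
apply: (@superlinear_of_small_steps _ _ r
  (fun k => Num.sqrt (lambda k / B) + 4 * lambda k / (K * P))).
- by move=> k; exact: normr_ge0.
- by move=> k; rewrite addr_ge0 ?sqrtr_ge0// divr_ge0 ?mulr_ge0// ltW.
- have -> : (0 : R) = Num.sqrt (0 / B) + 4 * 0 / (K * P).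
    by rewrite mulr0 !mul0r sqrtr0 addr0.
  apply: cvgD; last by apply: cvgMl; exact: cvgMr.
  apply: (continuous_cvg _ (@sqrt_continuous R (0 / B))).
  exact: cvgMl.
- move=> k.
  have h1 := ler_distD (x k.+2) (x k.+1) xs.
  rewrite (distrC _ (x k.+2)) -hr in h1.
  apply: (le_trans h1); rewrite mulrDl; apply: lerD; first exact: step.
  apply: (le_trans (hxs k.+1)).
  have -> : 4 * lambda k / (K * P) * r k = 4 * (lambda k * r k / P) / K.
    by field; rewrite !gt_eqF.
  rewrite ler_pM2r ?invr_gt0// ler_wpM2l// ler_pdivlMr// mulrC.
  exact: sqrt_value_le_step.
- move=> k; rewrite hr [leRHS]addrC.
  have := ler_distD xs (x k.+1) (x k).
  by rewrite (distrC xs).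
Qed.

End DescentSequence.

(** * One regularised Newton step *)

Section NewtonStep.
Context {R : realType} {E : completeNormedModType R}.
Variables (dot : {dot E for idfun}) (f : E -> R) (psi : E -> \bar R).
Variables (H : E -> {symmetric E}) (L : R).
Hypothesis hdot : hilbert_norm dot.
Hypothesis f_diff : forall x, differentiable f x.
Hypothesis psi_proper : proper_efun psi.
Hypothesis H_bounded : forall x, bounded_operator (H x).
Hypothesis hfH : forall x y,
  dual_norm (fun v => 'd f y v - 'd f x v - H x (y - x) v) <= L * `|x - y|.

Definition real_objective (x : E) : R := f x + fine (psi x).

Lemma objectiveE x : psi x \is a fin_num ->
  objective f psi x = (real_objective x)%:E.
Proof. by move=> xfin; rewrite /objective -{1}(fineK xfin) -EFinD. Qed.

Lemma effective_domain_fin x :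
  effective_domain (objective f psi) x -> psi x \is a fin_num.
Proof.
case: psi_proper => /(_ x) xN _; rewrite /effective_domain /objective /=.
by case: (psi x) xN => [a||] // xN; rewrite ?addey ?ltxx.
Qed.

Lemma subdifferential_fin x g : subdifferential psi x g -> psi x \is a fin_num.
Proof.
move=> [_ hg]; case: psi_proper => pN [y /= yfin].
have := hg y; have := pN x; case: (psi x) => [a||] // _.
by rewrite leye_eq => /eqP yE; rewrite /effective_domain /= yE in yfin.
Qed.

Lemma in_dual_newton_error x y :
  in_dual (fun v => 'd f y v - 'd f x v - H x (y - x) v).
Proof.
apply: in_dualD; last by apply: in_dualN; exact: (H_bounded x).1.
by apply: in_dualD; [|apply: in_dualN]; exact: in_dual_diff.
Qed.

Lemma newton_error_le x y v :
  `|'d f y v - 'd f x v - H x (y - x) v| <= L * `|y - x| * `|v|.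
Proof.
apply: (le_trans (dual_norm_pairing v (in_dual_newton_error x y))).
by rewrite ler_wpM2r// (distrC y).
Qed.

(** Along the segment the derivative error at [x + t d] in direction [d] is at
    most [t L |d|^2], since [H x] is linear; integrating gives [L |d|^2 / 2]. *)
Lemma newton_taylor_upper x d :
  f (x + d) <= f x + 'd f x d + (H x d d + L * `|d| ^+ 2) / 2.
Proof.
apply: taylor_upper => // t /andP[t0 t1].
have := newton_error_le x (x + t *: d) d.
have -> : x + t *: d - x = t *: d by rewrite addrAC subrr add0r.
have -> : H x (t *: d) d = t * H x d d by rewrite linearZl_LR.
rewrite normrZ (ger0_norm (ltW t0)).
by move=> /(le_trans (ler_norm _)); lra.
Qed.

Lemma admissible_decrease x lambda xp : psi x \is a fin_num ->
  admissible dot f psi H x lambda xp ->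
  (lambda - L) / 2 * `|xp - x| ^+ 2 <= real_objective x - real_objective xp.
Proof.
move=> xfin [/subdifferential_fin xpfin].
rewrite /newton_model subrr linear0 linear0l normr0 expr0n /=.
rewrite -(fineK xfin) -(fineK xpfin) -!EFinD lee_fin => hD.
have := newton_taylor_upper x (xp - x); rewrite addrC subrK /real_objective.
lra.
Qed.

Lemma in_dual_step_F' x lambda xp : admissible dot f psi H x lambda xp ->
  in_dual (step_F' dot f H x lambda xp).
Proof. by move=> [[hp _] _]; apply: in_dualD => //; exact: in_dual_diff. Qed.

Lemma step_F'E x lambda xp v : step_F' dot f H x lambda xp v
  = ('d f xp v - 'd f x v - H x (xp - x) v) - lambda * dot (xp - x) v.
Proof. by rewrite /step_F' /step_psi'; ring. Qed.

(** Since [alpha <= 1 / 2], it suffices that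
    [|F'|^2 <= 2 lambda <F', x - xp>]; both sides contain the same multiple of
    [e d], and the difference of the quadratic terms is
    [lambda^2 |d|^2 - |e|^2], nonnegative because [L <= lambda]. *)
Lemma admissible_first_test x lambda xp alpha : 0 < lambda -> L <= lambda ->
  alpha <= 1 / 2 -> admissible dot f psi H x lambda xp ->
  alpha / lambda * dual_norm (step_F' dot f H x lambda xp) ^+ 2
    <= step_F' dot f H x lambda xp (x - xp).
Proof.
move=> l0 Ll a12 adm; set d := xp - x.
pose e v := 'd f xp v - 'd f x v - H x d v.
have FE : step_F' dot f H x lambda xp = (fun v => e v - lambda * dot d v).
  by apply/funext => v; rewrite step_F'E.
have Fd := in_dual_step_F' adm; rewrite FE in Fd *.
have eN w : `|e w| <= (lambda * `|d|) * `|w|.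
  apply: (le_trans (newton_error_le _ _ _)).
  by rewrite ler_wpM2r// ler_wpM2r.
have := dual_norm_sub_riesz (e := e) hdot (in_dual_newton_error x xp).1 eN Fd.
set N := dual_norm _ => hN.
have -> : x - xp = - d by rewrite opprB.
have eNd : e (- d) = - e d.
  rewrite -scaleN1r (in_dualZ (g := e) _ _ (in_dual_newton_error x xp)).
  by rewrite mulN1r.
rewrite eNd linearN /= -hdot.
rewrite mulrAC ler_pdivrMr//.
apply: (@le_trans _ _ (1 / 2 * N ^+ 2)); first by rewrite ler_wpM2r ?sqr_ge0.
by nra.
Qed.

(** The decrease [(lambda - L) / 2 |xp - x|^2] of an admissible step dominates
    [beta lambda |xp - x|^2] precisely because [beta <= (m - 1) / (2 m)] and
    [L <= lambda / m]. *)
Lemma accepted_large x lambda xp m alpha beta : psi x \is a fin_num ->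
  0 < m -> 0 < lambda -> L <= lambda -> m * L <= lambda -> alpha <= 1 / 2 ->
  beta <= (m - 1) / (2 * m) -> admissible dot f psi H x lambda xp ->
  accepted dot f psi H alpha beta x lambda xp.
Proof.
move=> xfin m0 l0 Ll mL a12 bm adm; split; first exact: admissible_first_test.
have xpfin := subdifferential_fin adm.1.
rewrite (objectiveE xfin) (objectiveE xpfin).
rewrite -EFinB lee_fin; apply: le_trans (admissible_decrease xfin adm).
rewrite ler_wpM2r ?sqr_ge0//.
have h : beta * lambda <= (m - 1) / (2 * m) * lambda.
  by rewrite ler_wpM2r ?(ltW l0).
apply: (le_trans h); have -> : (m - 1) / (2 * m) * lambda
   = (lambda - lambda / m) / 2 by field; rewrite gt_eqF.
have : L <= lambda / m by rewrite ler_pdivlMr// mulrC.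
by lra.
Qed.

Lemma PL_value_le (Fstar mu : R) x g : 0 < mu -> PL_condition f psi Fstar mu ->
  in_dual g -> objective_subdifferential f psi x g ->
  psi x \is a fin_num ->
  2 * mu * (real_objective x - Fstar) <= dual_norm g ^+ 2.
Proof.
move=> mu0 hPL gd gsub xfin.
have xdom : effective_domain (objective f psi) x.
  by rewrite /effective_domain /= objectiveE// ltry.
have := hPL x xdom; rewrite objectiveE// -EFinB => h.
have dle : (dist0_subdifferential f psi x <= (dual_norm g)%:E)%E.
  by apply: ge_ereal_inf; exists (dual_norm g)%:E => //; exists g.
have d0 : (0 <= dist0_subdifferential f psi x)%E.
  apply: le_ereal_inf_tmp => _ [g' [p [pd _] <-] <-].
  rewrite lee_fin dual_norm_ge0//.
  by apply: in_dualD => //; exact: in_dual_diff.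
have sq : (dist0_subdifferential f psi x ^+ 2 <= (dual_norm g ^+ 2)%:E)%E.
  by rewrite EFin_expe lee_sqr// lee_fin dual_norm_ge0.
have : ((real_objective x - Fstar)%:E
    <= ((2 * mu)^-1 * dual_norm g ^+ 2)%:E)%E.
  apply: (le_trans h); rewrite EFinM lee_pmul2l// lte_fin invr_gt0 mulr_gt0//.
by rewrite lee_fin ler_pdivlMl// mulr_gt0.
Qed.

(** The first acceptance test, by the Cauchy-Schwarz inequality for the
    pairing, says [alpha |F'| <= lambda |xp - x|]; the Polyak-Lojasiewicz
    inequality then replaces [|F'|^2] by [2 mu (F - Fstar)]. *)
Lemma accepted_value_le (Fstar mu alpha beta : R) x lambda xp : 0 < mu ->
  0 < alpha -> 0 < lambda ->
  PL_condition f psi Fstar mu -> admissible dot f psi H x lambda xp ->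
  accepted dot f psi H alpha beta x lambda xp ->
  2 * mu * alpha ^+ 2 * (real_objective xp - Fstar)
    <= (lambda * `|xp - x|) ^+ 2.
Proof.
move=> mu0 a0 l0 hPL adm [acc _].
have Fd := in_dual_step_F' adm.
have xpfin := subdifferential_fin adm.1.
have Fsub : objective_subdifferential f psi xp (step_F' dot f H x lambda xp).
  by exists (step_psi' dot f H x lambda xp); first exact: adm.1.
have := PL_value_le mu0 hPL Fd Fsub xpfin.
set N := dual_norm _ in acc * => hPLN.
have N0 : 0 <= N by exact: dual_norm_ge0.
have hF := le_trans (ler_norm _) (dual_norm_pairing (x - xp) Fd).
rewrite -/N distrC in hF.
have aN : alpha * N <= lambda * `|xp - x|.
  have [N00|N00] := eqVneq N 0; first by rewrite N00 mulr0 mulr_ge0// ltW.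
  have Np : 0 < N by rewrite lt_def N00.
  rewrite -(ler_pM2r Np) -mulrA -expr2.
  have := le_trans acc hF; rewrite mulrAC ler_pdivrMr//.
  by move=> h; lra.
have : (alpha * N) ^+ 2 <= (lambda * `|xp - x|) ^+ 2.
  by rewrite ler_sqr ?nnegrE ?mulr_ge0// ltW.
apply: le_trans; rewrite exprMn.
have := ler_wpM2l (sqr_ge0 alpha) hPLN; lra.
Qed.

(** If the value at the limit were larger than [F], some [b > F - f xs] would
    lie below [psi xs], hence eventually below
    [psi (x k) = F (x k) - f (x k)], which tends to [F - f xs]. *)
Lemma objective_limit_le (x : nat -> E) xs (F : R) :
  lower_semicontinuous psi ->
  (forall k, psi (x k) \is a fin_num) -> x @ \oo --> xs ->
  (fun k => real_objective (x k)) @ \oo --> F ->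
  (objective f psi xs <= F%:E)%E.
Proof.
move=> lsc xfin xcvg Fcvg; rewrite leNgt; apply/negP => gt.
have fcvg : (fun k => f (x k)) @ \oo --> f xs.
  exact: (continuous_cvg _ (differentiable_continuous (f_diff xs)) xcvg).
have psib : ((F - f xs)%:E < psi xs)%E.
  by rewrite EFinB lteBlDl.
have [b [Fb bpsi]] : exists b : R, F - f xs < b /\ (b%:E < psi xs)%E.
  move: psib; case: (psi xs) => [p||] // h.
    exists ((F - f xs + p) / 2); move: h; rewrite !lte_fin => h.
    by split; lra.
  by exists (F - f xs + 1); split; [lra|rewrite ltry].
have [V nV hV] := lsc xs b bpsi.
have : F - f xs >= b.
  have hc : (fun k => real_objective (x k) - f (x k)) @ \oo --> F - f xs.
    exact: cvgB.
  apply: (cvgr_to_ge hc).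
  have [N _ hN] := xcvg V nV; exists N => // k /= /hN /hV /=.
  rewrite -(fineK (xfin k)) lte_fin /real_objective; lra.
by rewrite leNgt Fb.
Qed.

(** * Runs of the algorithm *)

Variables (m alpha beta : R).
Hypotheses (L_ge0 : 0 <= L) (m_ge1 : 1 <= m) (alpha_le : alpha <= 1 / 2).
Hypothesis beta_le : beta <= (m - 1) / (2 * m).
Hypothesis hsub : subproblem_assumption dot f psi H L.

Lemma trial_rejected_lt x lambda : 0 < lambda -> psi x \is a fin_num ->
  trial_rejected dot f psi H alpha beta x lambda -> lambda < m * L.
Proof.
move=> l0 xfin rej; rewrite ltNge; apply/negP => mL.
have Ll : L <= lambda by apply: le_trans mL; rewrite ler_peMl.
case: rej => [|[xp [adm]]]; apply.
  apply: hsub => //; rewrite /effective_domain /= (objectiveE xfin).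
  exact: ltry.
by apply: (accepted_large (m := m)) => //; rewrite (lt_le_trans _ m_ge1).
Qed.

Variables (x0 : E) (psi'0 : E -> R) (Lambda0 : R).
Variables (x : nat -> E) (F' : nat -> E -> R) (lambda Lambda : nat -> R).
Variable j : nat -> nat.
Hypothesis x0_dom : effective_domain (objective f psi) x0.
Hypothesis Lambda0_gt0 : 0 < Lambda0.
Hypothesis run :
  LeAP_SSN dot f psi H alpha beta x0 psi'0 Lambda0 x F' lambda Lambda j.

Lemma run_fin k : psi (x k) \is a fin_num.
Proof.
case: k => [|k]; first by rewrite (leap_x0 run); exact: effective_domain_fin.
exact: subdifferential_fin (leap_admissible run k).1.
Qed.

Lemma run_Lambda_gt0 k : 0 < Lambda k.
Proof.
elim: k => [|k IH]; first by rewrite (leap_Lambda0 run).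
by rewrite (leap_Lambda run) (leap_lambda run) divr_gt0// mulr_gt0// exprn_gt0.
Qed.

Lemma run_lambda_gt0 k : 0 < lambda k.
Proof.
by rewrite (leap_lambda run) mulr_gt0 ?run_Lambda_gt0// exprn_gt0.
Qed.

(** When a trial was rejected, the previous parameter was half of [lambda k]
    and below [m L]; otherwise [lambda k = Lambda k], which is either [Lambda0]
    or half of the preceding parameter. *)
Lemma run_lambda_le k : lambda k <= Num.max (2 * m * L) Lambda0.
Proof.
have step i : Lambda i <= Num.max (2 * m * L) Lambda0 ->
    lambda i <= Num.max (2 * m * L) Lambda0.
  move=> Li; rewrite (leap_lambda run).
  have rej n (nj : (n < j i)%N) := leap_rejected run nj.
  case: (j i) rej => [|n] rej; first by rewrite expr0 mul1r.
  have := trial_rejected_lt _ (run_fin i) (rej n (ltnSn n)).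
  rewrite mulr_gt0 ?run_Lambda_gt0 ?exprn_gt0// => /(_ isT) h.
  by rewrite le_max exprS; apply/orP; left; lra.
elim: k => [|k IH]; apply: step.
  by rewrite (leap_Lambda0 run) le_max lexx orbT.
rewrite (leap_Lambda run); apply: le_trans IH.
by rewrite ler_pdivrMr// ler_peMr ?(ltW (run_lambda_gt0 k))// ler1n.
Qed.

Lemma run_trial_count k :
  (2 : R) ^+ (\sum_(0 <= i < k) j i) * Lambda0 = 2 ^+ k * Lambda k.
Proof.
elim: k => [|k IH]; first by rewrite big_geq// (leap_Lambda0 run).
rewrite big_nat_recr//= exprD mulrAC IH (leap_Lambda run) (leap_lambda run).
by rewrite exprS; field.
Qed.

(** [Lambda k.+1] is half of [lambda k], hence at most
    [max (1 / 2) (m L / Lambda0) * Lambda0]; take the logarithm of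
    [run_trial_count]. *)
Lemma run_trial_count_log2 k : (\sum_(0 <= i < k.+1) j i)%:R
  <= k.+1%:R + log2 (Num.max (1 / 2) (m * L / Lambda0)).
Proof.
set Z := Num.max _ _; set n := (\sum_(_ <= _ < _) _)%N.
have Z0 : 0 < Z by rewrite lt_max divr_gt0.
have ln20 : 0 < ln (2 : R) by rewrite ln_gt0// ltr1n.
have LZ : Lambda k.+1 <= Z * Lambda0.
  rewrite maxr_pMl ?(ltW Lambda0_gt0)// divfK ?gt_eqF// (leap_Lambda run).
  have := run_lambda_le k; rewrite !le_max.
  by case/orP => h; apply/orP; [right|left]; lra.
have h : (2 : R) ^+ n <= 2 ^+ k.+1 * Z.
  rewrite -(ler_pM2r Lambda0_gt0) run_trial_count -mulrA.
  by rewrite ler_wpM2l// exprn_ge0.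
rewrite /log2 -(ler_pM2r ln20) mulrDl divfK ?gt_eqF//.
rewrite !mulr_natl -!lnXn// -lnM ?posrE ?exprn_gt0//.
by rewrite ler_ln ?posrE ?mulr_gt0 ?exprn_gt0.
Qed.

End NewtonStep.

Unset Implicit Arguments.

(** * Convergence of the method *)

Theorem theorem4p3 (R : realType) (E : completeNormedModType R)
  (dot : {dot E for idfun}) (hdot : hilbert_norm dot)
  (f : E -> R) (hf : C11 f)
  (psi : E -> \bar R) (hpsi_proper : proper_efun psi)
  (hpsi_convex : convex_efun psi) (hpsi_lsc : lower_semicontinuous psi)
  (Fstar : R) (hFstar : forall x, (Fstar%:E <= objective f psi x)%E)
  (hS : solution_set f psi Fstar !=set0)
  (H : E -> {symmetric E}) (hH : forall x, bounded_operator (H x))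
  (L : R) (hL : 0 <= L)
  (hfH : forall x y,
    dual_norm (fun v => 'd f y v - 'd f x v - H x (y - x) v) <= L * `|x - y|)
  (hsub : subproblem_assumption dot f psi H L)
  (mu : R) (hmu : 0 < mu) (hPL : PL_condition f psi Fstar mu)
  (m alpha beta : R) (hm : 1 <= m) (halpha : 0 < alpha <= 1 / 2)
  (hbeta : 0 < beta <= (m - 1) / (2 * m))
  (x0 : E) (hx0 : effective_domain (objective f psi) x0)
  (psi'0 : E -> R) (hpsi'0 : subdifferential psi x0 psi'0)
  (Lambda0 : R) (hLambda0 : 0 < Lambda0)
  (x : nat -> E) (F' : nat -> E -> R) (lambda Lambda : nat -> R) (j : nat -> nat)
  (hrun : LeAP_SSN dot f psi H alpha beta x0 psi'0 Lambda0 x F' lambda Lambda j) :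

  ((forall k : nat,
      (objective f psi (x k) - Fstar%:E <=
       (expR (- (2 * beta * alpha ^+ 2 * mu /
                 (2 * beta * alpha ^+ 2 * mu + Num.max (2 * m * L) Lambda0)
                 * k%:R)))%:E
       * (objective f psi x0 - Fstar%:E))%E) /\
   (lambda @ \oo --> (0 : R) ->
      superlinear (fun k => fine (objective f psi (x k)) - Fstar)))
  /\

  (exists xs : E,
     [/\ solution_set f psi Fstar xs,
         x @ \oo --> xs,
         (forall k : nat, (2 <= k)%N ->
            `|x k - xs| <=
            expR (- (2 * beta * alpha ^+ 2 * mu /
                     (4 * beta * alpha ^+ 2 * mu
                      + 2 * Num.max (2 * m * L) Lambda0)
                     * (k - 2)%:R))
            * (5 * Num.sqrt (fine (objective f psi x0) - Fstar)
               / (alpha * beta * Num.sqrt mu))) &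
         (lambda @ \oo --> (0 : R) -> superlinear (fun k => `|x k - xs|))])
  /\

  (forall k : nat,
     (\sum_(0 <= i < k.+1) j i)%:R
     <= k.+1%:R + log2 (Num.max (1 / 2) (m * L / Lambda0))).
Proof.
have [f_diff _] := hf.
have [alpha_gt0 alpha_le] := andP halpha.
have [beta_gt0 beta_le] := andP hbeta.
pose F := real_objective f psi.
have xfin k : psi (x k) \is a fin_num.
  exact: (run_fin hpsi_proper hx0 hrun k).
have FE k : objective f psi (x k) = (F (x k))%:E by exact: objectiveE.
have lambda_gt0 k : 0 < lambda k by exact: (run_lambda_gt0 hLambda0 hrun k).
have lambda_le k : lambda k <= Num.max (2 * m * L) Lambda0.
  exact: (run_lambda_le hdot f_diff hpsi_proper hH hfH hL hm alpha_le beta_le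
    hsub hx0 hLambda0 hrun k).
pose a k := F (x k) - Fstar; pose r k := `|x k.+1 - x k|.
have a_ge0 k : 0 <= a k by rewrite subr_ge0 -lee_fin -FE.
have r_ge0 k : 0 <= r k by exact: normr_ge0.
have lambda_half k : lambda k / 2 <= lambda k.+1.
  rewrite -(leap_Lambda hrun) (leap_lambda hrun k.+1) ler_peMl//.
    exact: (ltW (run_Lambda_gt0 hLambda0 hrun _)).
  by rewrite exprn_ege1// ler1n.
have descent k : beta * lambda k * r k ^+ 2 <= a k - a k.+1.
  by have [_] := leap_accepted hrun k; rewrite !FE -EFinB lee_fin /a /r; lra.
have PL_step k : 2 * mu * alpha ^+ 2 * a k.+1 <= (lambda k * r k) ^+ 2.
  exact: (accepted_value_le f_diff hpsi_proper hmu alpha_gt0 (lambda_gt0 k) hPL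
    (leap_admissible hrun k) (leap_accepted hrun k)).
have objE k : fine (objective f psi (x k)) - Fstar = a k by rewrite FE.
have x0E : x 0%N = x0 := leap_x0 hrun.
split.
  split=> [k|l0].
    rewrite -x0E !FE -!EFinB -EFinM lee_fin -/(a k) -/(a 0%N).
    exact: (value_linear_rate alpha_gt0 beta_gt0 hmu a_ge0 r_ge0 lambda_gt0
      descent PL_step k lambda_le).
  rewrite (funext objE : (fun k => _) = a).
  exact: (value_superlinear alpha_gt0 beta_gt0 hmu a_ge0 lambda_gt0
    descent PL_step l0).
split; last first.
  exact: (run_trial_count_log2 hdot f_diff hpsi_proper hH hfH hL hm alpha_le
    beta_le hsub hx0 hLambda0 hrun).
have [xs xcvg hxs] := trajectory_cvg alpha_gt0 beta_gt0 hmu a_ge0 r_ge0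
  lambda_gt0 lambda_half descent PL_step (fun=> erefl) lambda_le.
exists xs; split => //.
- apply/eqP; rewrite eq_le hFstar andbT.
  apply: (objective_limit_le f_diff hpsi_lsc xfin xcvg).
  have acvg := value_cvg0 alpha_gt0 beta_gt0 hmu a_ge0 r_ge0 lambda_gt0
    descent PL_step lambda_le.
  have -> : (fun k => real_objective f psi (x k)) = (fun k => a k + Fstar).
    by apply/funext => k; rewrite /a subrK.
  by rewrite -[X in _ --> X]add0r; exact: cvgD acvg (cvg_cst _).
- case=> [|[|k]]// _; apply: (le_trans (hxs k.+1)).
  rewrite -x0E objE subn2 /=.
  have := trajectory_linear_rate alpha_gt0 beta_gt0 hmu a_ge0 r_ge0
    lambda_gt0 descent PL_step k lambda_le.
  have -> : 2 * (2 * beta * alpha ^+ 2 * mu + Num.max (2 * m * L) Lambda0)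
    = 4 * beta * alpha ^+ 2 * mu + 2 * Num.max (2 * m * L) Lambda0 by ring.
  by [].
- exact: (trajectory_superlinear alpha_gt0 beta_gt0 hmu a_ge0 r_ge0
    lambda_gt0 lambda_half descent PL_step (fun=> erefl) hxs).
Qed.
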